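(* Let $EP: S_0,S_1,S_2,\dots,S_{n-1},S_n$ be a unified path of length $n\geq 2$ with $|S_i|>1$ for some $i\in\{0,1,\dots,n\}$. Then the unified eigenvalues of $EP$ are (i) $2\cos\left(\frac{\pi k}{n+2}\right)$ with multiplicity $1$ for $k=1,2,\dots,n+1$; (ii) $\pm1$ with multiplicity $$t=\begin{cases} t_1, & \text{if } |S_0|=|S_n|=1;\\ t_1+2^{|S_n|}-2, & \text{if } |S_0|=1 \text{ and } |S_n|>1;\\ t_1+2^{|S_0|}-2, & \text{if } |S_n|=1 \text{ and } |S_0|>1;\\ t_1+2^{|S_0|}+2^{|S_n|}-4, & \text{if } |S_0|>1 \text{ and } |S_n|>1,\end{cases}$$ provided $|S_{i-1}|>1$ and $|S_i|>1$ for at least one $i\in\{1,2,\dots,n\}$, where $t_1=\sum_{i=1}^n p_i$ and, for $i=1,2,\dots,n$, $$p_i=\begin{cases}0, & \text{if } |S_{i-1}|=1 \text{ or } |S_i|=1,\\ \dfrac12\displaystyle\sum_{\substack{1\le l_1<|S_{i-1}|;\\ 1\le l_2<|S_i|}}\binom{|S_{i-1}|}{l_1}\binom{|S_i|}{l_2}, & \text{otherwise};\end{cases}$$ (iii) $0$ and $\pm\sqrt2$ with multiplicity $$t'=\frac12\left[\Big(\sum_{e\in E(EP)}|\tau(e)|\Big)-n-t\right],$$ provided $\sum_{e\in E(EP)}|\tau(e)|\neq n+t$.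
   Context: A hypergraph $H$ consists of a finite non-empty vertex set $V(H)$ and a multiset $E(H)$ of non-empty subsets of $V(H)$, called edges. The multiplicity $m(e)$ of an edge $e$ is its number of occurrences in $E(H)$. A 2-partition of a set $e$ is an unordered pair $\{S,S'\}$ of non-empty disjoint sets with $S\cup S'=e$; $S$ and $S'$ are called parts of $e$, and $\tau(e)$ is the set of all 2-partitions of $e$. $I(H)$ is the set of all parts of all edges of $H$ together with all singleton subsets of $V(H)$. The unified matrix $\mathbf{U}(H)$ is the matrix with rows and columns indexed by $I(H)$ whose $(S,S')$ entry is $m(S)$ if $S=S'$ is a singleton which is an edge of $H$; is $m(e)$ if $\{S,S'\}$ is a 2-partition of an edge $e$ of $H$; and is $0$ otherwise. The unified eigenvalues of $H$ are the eigenvalues of $\mathbf{U}(H)$. An exact walk of length $n$ in $H$ is a sequence $S_0,e_1,S_1,e_2,S_2,\dots,e_n,S_n$ in which $\{S_{i-1},S_i\}$ is a 2-partition of the edge $e_i$ of $H$ for $i=1,\dots,n$; the sets $S_0,\dots,S_n$ are its parts, and it may be written simply $S_0,S_1,\dots,S_n$. An exact path is an exact walk all of whose parts are distinct. A unified path is a hypergraph with at least two distinct edges whose edges and some of their parts can be arranged in an exact path sequence whose parts are pairwise disjoint; a unified path is specified by (and identified with) such an exact path $S_0,S_1,\dots,S_n$, and $n$ is its length.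
   Formalization: The proviso in (ii) is widened to ''|S_{i-1}|>1 and |S_i|>1 for some i, or |S_0|>1, or |S_n|>1'': as written the list is incomplete, e.g. S_0={a,b}, S_1={c}, S_2={d} has eigenvalues ±1 with multiplicity t=2 although no two consecutive parts are big. *)

(* Defs.v *)
From mathcomp Require Import all_boot all_order all_algebra.
From mathcomp Require Import reals trigo.

Set Implicit Arguments.
Unset Strict Implicit.
Unset Printing Implicit Defensive.

Import Order.TTheory GRing.Theory Num.Theory.

(* The vertex set is the whole finite type V; the multiset of edges is a
   sequence, whose order is irrelevant. *)
Record hypergraph (V : finType) := Hypergraph {
  hedges : seq {set V};
  hvertex_gt0 : 0 < #|V|;
  hedges_neq0 : set0 \notin hedges
}.

Definition mult (V : finType) (H : hypergraph V) (e : {set V}) : nat :=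
  count_mem e (hedges H).

Definition tau (V : finType) (e : {set V}) : {set {set {set V}}} :=
  [set P | partition P e & #|P| == 2].

Definition parts (V : finType) (e : {set V}) : {set {set V}} := cover (tau e).

Definition unified_index (V : finType) (H : hypergraph V) : {set {set V}} :=
  [set S | has (fun e => S \in parts e) (hedges H)]
    :|: [set [set x] | x in [set: V]].

(* The edge picked in the second case can only be S :|: S'. *)
Definition unified_entry (V : finType) (H : hypergraph V) (S S' : {set V}) : nat :=
  if [&& S == S', #|S| == 1 & S \in hedges H] then mult H S
  else if [pick e | (e \in hedges H) && ([set S; S'] \in tau e)] is Some e
  then mult H e else 0.

Definition unified_matrix (R : nzRingType) (V : finType) (H : hypergraph V) :
    'M[R]_(#|unified_index H|) :=
  \matrix_(i, j) (unified_entry H (enum_val i) (enum_val j))%:R%R.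

(* s lists the unified eigenvalues, with (algebraic) multiplicity: a value
   occurring several times in s has its multiplicities added up.  The complete
   factorization also excludes non-real eigenvalues. *)
Definition unified_eigenvalues (R : realType) (V : finType) (H : hypergraph V)
    (s : seq R) : Prop :=
  char_poly (unified_matrix R H) = (\prod_(x <- s) ('X - x%:P))%R.

(* Walks are given by their parts S_0, ..., S_n; the edges are recovered as
   e_i = S_(i-1) :|: S_i. *)
Definition exact_walk (V : finType) (H : hypergraph V) (S : seq {set V}) : bool :=
  (S != [::]) &&
  sorted (fun A B => has (fun e => [set A; B] \in tau e) (hedges H)) S.

Definition exact_path (V : finType) (H : hypergraph V) (S : seq {set V}) : bool :=
  exact_walk H S && uniq S.

Definition walk_edges (V : finType) (S : seq {set V}) : seq {set V} :=
  [seq nth set0 S i :|: nth set0 S i.+1 | i <- iota 0 (size S).-1].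

(* H is identified with the path: its edges are e_1, ..., e_n, each with
   multiplicity 1, and every vertex lies in one of the S_i. *)
Definition unified_path (V : finType) (H : hypergraph V) (S : seq {set V}) : bool :=
  [&& 1 < size (undup (hedges H)),
      exact_path H S,
      pairwise (fun A B : {set V} => [disjoint A & B]) S,
      perm_eq (hedges H) (walk_edges S)
    & \bigcup_(A <- S) A == [set: V]].

Section Multiplicities.
Variables (V : finType) (n : nat) (S : n.+1.-tuple {set V}).

Definition part_size (i : nat) : nat := #|nth set0 S i|.

(* The double sum is (2 ^ a - 2) * (2 ^ b - 2), where a and b are the two part
   sizes, so that the halving is exact. *)
Definition path_p (i : nat) : nat :=
  let a := part_size i.-1 in
  let b := part_size i in
  if (a == 1) || (b == 1) then 0
  else (\sum_(1 <= l1 < a) \sum_(1 <= l2 < b) 'C(a, l1) * 'C(b, l2))./2.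

Definition path_t1 : nat := \sum_(1 <= i < n.+1) path_p i.

Definition path_t : nat :=
  let a := part_size 0 in
  let b := part_size n in
  if a == 1 then
    if b == 1 then path_t1 else path_t1 + 2 ^ b - 2
  else
    if b == 1 then path_t1 + 2 ^ a - 2 else path_t1 + 2 ^ a + 2 ^ b - 4.

Definition tau_total (H : hypergraph V) : nat := \sum_(e <- hedges H) #|tau e|.

(* On a unified path, tau_total H - n - path_t is twice the number of non-empty
   proper subsets of S_1, ..., S_(n-1): neither the subtraction nor the halving
   truncates. *)
Definition path_t' (H : hypergraph V) : nat := (tau_total H - n - path_t)./2.

Definition consecutive_big : bool :=
  [exists i : 'I_n, (1 < part_size i) && (1 < part_size i.+1)].

End Multiplicities.

(* Main.v *)
Require Import Defs.
From mathcomp Require Import all_boot all_order all_algebra perm.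
From mathcomp Require Import reals trigo.
From mathcomp Require Import ring zify.

Set Implicit Arguments.
Unset Strict Implicit.
Unset Printing Implicit Defensive.

Import Order.TTheory GRing.Theory Num.Theory.
Local Open Scope ring_scope.

(** Write P_0, ..., P_n for the parts S_0, ..., S_n of the path, and e_i for
    the edge P_i :|: P_(i+1), where i < n.  The unified matrix is the adjacency
    matrix of a graph on the non-empty proper subsets of the edges, A being
    adjacent to e_i :\: A for every edge e_i that properly contains it.

    Say that A splits P_k if A contains some but not all vertices of P_k.
    Since A and e_i :\: A split the same P_k, the set of the k such that A
    splits P_k is constant on connected components, and it determines their
    shape.
    - If A splits no P_k, then A is one of the P_k; these form the path
      P_0 - P_1 - ... - P_n.
    - If A splits exactly one P_j, its component is a star: the centre is a
      non-empty proper subset B of P_j, and the leaves are the sets e_i :\: B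
      for the edges e_i that contain P_j.  There are two such edges if
      0 < j < n and only one if j is 0 or n, and P_j has 2 ^ #|P_j| - 2
      non-empty proper subsets.
    - If A splits two parts, these are P_i and P_(i+1) for some i, and A lies
      in e_i only, so that its component is the single edge {A, e_i :\: A}.
      There are (2 ^ #|P_i| - 2) * (2 ^ #|P_(i+1)| - 2) such A.
    This decomposition is [path_parts_decomposition].

    The characteristic polynomial is multiplicative over the components, which
    gives [set_det_path_parts].  A single edge contributes X^2 - 1, with roots
    1 and -1; a star with two leaves contributes X^3 - 2 X, with roots 0 and
    plus or minus the square root of 2; and the path on n + 1 vertices
    contributes the Chebyshev polynomial U_(n+1)(X/2), whose roots are the
    2 cos (pi k / (n+2)) ([path_poly_factor]).

    The single edges, including the stars at the two ends, number t.  Counting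
    all edges of the graph, which are the 2-partitions of the e_i, gives n from
    the path, t from the single edges and two from each of the other stars
    ([tau_total_path]); hence there are t' stars with two leaves. *)

(** * Determinants indexed by sequences and by sets *)

Section SeqDet.
Variables (K : comNzRingType) (T : eqType) (F : T -> T -> K).

Definition seq_det (s : seq T) : K :=
  \det (\matrix_(i < size s, j < size s)
          F (tnth (in_tuple s) i) (tnth (in_tuple s) j)).

Lemma seq_detE x0 (s : seq T) n : size s = n ->
  seq_det s = \det (\matrix_(i < n, j < n) F (nth x0 s i) (nth x0 s j)).
Proof.
by move<-; congr (\det _); apply/matrixP=> i j; rewrite !mxE !(tnth_nth x0).
Qed.

Lemma seq_det_nil : seq_det [::] = 1.
Proof. exact: det_mx00. Qed.

Lemma seq_det1 x : seq_det [:: x] = F x x.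
Proof. by rewrite (seq_detE x (n := 1)) // det_mx11 mxE. Qed.

Lemma seq_det_perm (s1 s2 : seq T) : perm_eq s1 s2 -> seq_det s1 = seq_det s2.
Proof.
case: s2 => [/perm_nilP -> // | x0 s2']; set s2 := x0 :: s2' => eq12.
have /tuple_permP[p def_s1] : perm_eq s1 (in_tuple s2) by [].
have nth_s1 (i : 'I_(size s2)) : nth x0 s1 i = nth x0 s2 (p i).
  by rewrite def_s1 (nth_mktuple _ x0) (tnth_nth x0).
rewrite (seq_detE x0 (perm_size eq12)) (seq_detE x0 (erefl (size s2))).
set A := (\matrix_(i, j) F (nth x0 s2 i) _).
transitivity (\det (col_perm p (row_perm p A))).
  by congr (\det _); apply/matrixP=> i j; rewrite !mxE !nth_s1.
rewrite col_permE row_permE !det_mulmx !det_perm odd_permV mulrAC.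
by rewrite -signr_addb addbb mul1r.
Qed.

Lemma seq_det_cat (s1 s2 : seq T) :
  (forall x y, x \in s1 -> y \in s2 -> F y x = 0) ->
  seq_det (s1 ++ s2) = seq_det s1 * seq_det s2.
Proof.
case: s1 => [_|x0 s1']; first by rewrite seq_det_nil mul1r.
set s1 := x0 :: s1' => F0.
rewrite (seq_detE x0 (size_cat s1 s2)) (seq_detE x0 (erefl (size s1))).
rewrite (seq_detE x0 (erefl (size s2))).
set A := \matrix_(i, j) _; rewrite -(submxK A).
have -> : dlsubmx A = 0.
  apply/matrixP=> i j; rewrite !mxE !nth_cat /= ltn_ord.
  by rewrite ltnNge leq_addr /= F0 ?addKn ?mem_nth.
rewrite det_ublock; congr (_ * _); congr (\det _); apply/matrixP=> i j.
  by rewrite !mxE !nth_cat /= !ltn_ord.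
by rewrite !mxE !nth_cat /= !ltnNge !leq_addr /= !addKn.
Qed.

(** The case of a vertex x whose only neighbour is y: the minor of F x y in the
    expansion along the row of x has F y x as the only non-zero entry of its
    first column.  Paths and stars are peeled off with this recurrence. *)
Lemma seq_det_cons2 x y (s : seq T) :
  {in s, forall z, F x z = 0 /\ F z x = 0} ->
  seq_det (x :: y :: s) = F x x * seq_det (y :: s) - F x y * F y x * seq_det s.
Proof.
move=> F0; have F0n (i : 'I_(size s)) := F0 _ (mem_nth x (ltn_ord i)).
rewrite (@seq_detE x _ (size s).+2) // (expand_det_row _ 0).
rewrite big_ord_recl big_ord_recl big1 ?addr0; last first.
  by move=> i _; rewrite !mxE /= (F0n i).1 mul0r.
rewrite !mxE /=; congr (_ * _ + _).
  rewrite /cofactor expr0 mul1r (@seq_detE x _ (size s).+1) //; congr (\det _).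
  by apply/matrixP=> i j; rewrite !mxE.
rewrite /cofactor /= expr1 mulN1r mulrN -mulrA; congr (- (_ * _)).
rewrite (expand_det_col _ 0) big_ord_recl big1 ?addr0; last first.
  by move=> i _; rewrite !mxE /= (F0n i).2 mul0r.
rewrite !mxE /=; congr (_ * _).
rewrite /cofactor expr0 mul1r (@seq_detE x _ (size s)) //; congr (\det _).
by apply/matrixP=> i j; rewrite !mxE.
Qed.

End SeqDet.

Section SetDet.
Variables (K : comNzRingType) (T : finType) (F : T -> T -> K).
Hypothesis F_diag : forall x, F x x != 0.

Local Notation D A := (seq_det F (enum A)).

Lemma set_det0 : D (set0 : {set T}) = 1.
Proof. by rewrite enum_set0 seq_det_nil. Qed.

Lemma seq_det_set (s : seq T) : uniq s -> seq_det F s = D [set x in s].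
Proof.
move=> us; apply: seq_det_perm; apply: uniq_perm; rewrite ?enum_uniq //.
by move=> x; rewrite mem_enum inE.
Qed.

(** Placing A before B makes the matrix block triangular.  The non-zero
    diagonal forces A and B to be disjoint. *)
Lemma set_detU (A B : {set T}) :
  (forall x y, x \in A -> y \in B -> F y x = 0) ->
  D (A :|: B) = D A * D B.
Proof.
move=> F0; rewrite -seq_det_cat; last first.
  by move=> x y; rewrite !mem_enum; apply: F0.
apply: seq_det_perm; apply: uniq_perm; rewrite ?enum_uniq //; last first.
  by move=> x; rewrite mem_cat !mem_enum inE.
rewrite cat_uniq !enum_uniq andbT /=.
apply/hasPn => x; rewrite !mem_enum => xB; apply/negP => xA.
by have := F_diag x; rewrite F0 ?eqxx.
Qed.

Lemma set_det_bigcup (I : finType) (J : {pred I}) (A : I -> {set T}) :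
  (forall i j x y, i \in J -> j \in J -> i != j ->
     x \in A i -> y \in A j -> F y x = 0) ->
  D (\bigcup_(i in J) A i) = \prod_(i in J) D (A i).
Proof.
rewrite -!big_enum /= => F0.
have sub_enum : {subset enum J <= J} by move=> i; rewrite mem_enum.
elim: (enum J) (enum_uniq J) sub_enum => [_ _|i s IHs].
  by rewrite !big_nil set_det0.
rewrite cons_uniq => /andP[i_s us] sub_s.
rewrite !big_cons set_detU.
  by rewrite IHs // => j js; apply: sub_s; rewrite inE js orbT.
move=> x y xi; rewrite bigcup_seq => /bigcupP[j js yj].
apply: (F0 i j) xi yj; rewrite ?sub_s ?inE ?eqxx ?js ?orbT //.
by apply: contraNneq i_s => ->.
Qed.

(** A perfect matching: removing a pair {x, phi x} leaves a set that phi still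
    maps to itself, so that each of the #|A|./2 pairs contributes a factor. *)
Lemma set_det_involution (c : K) (phi : T -> T) (A : {set T}) :
  {in A, forall x, [/\ phi x \in A, phi (phi x) = x & phi x != x]} ->
  {in A, forall x, seq_det F [:: x; phi x] = c} ->
  {in A &, forall x y, x != y -> y != phi x -> F y x = 0} ->
  D A = c ^+ (#|A|./2).
Proof.
have [m] := ubnP #|A|; elim: m => // m IHm in A *;
  rewrite ltnS => leAm phiA cA F0.
have [->|[x xA]] := set_0Vmem A; first by rewrite set_det0 cards0.
have [pA ppx pNx] := phiA x xA.
pose B := A :\ x :\ phi x.
have cardA : #|A| = #|B|.+2.
  by rewrite (cardsD1 x) xA (cardsD1 (phi x) (A :\ x)) !inE pNx pA.
have eqA : A = [set y in [:: x; phi x]] :|: B.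
  apply/setP=> y; rewrite !inE.
  by case: eqP => [->|_] //=; case: eqP => [->|_].
have phiB y : y \in B -> phi y \in B.
  rewrite !inE => /and3P[y1 y2 yA]; have [-> ppy _] := phiA y yA.
  rewrite andbT -{1}ppx; apply/andP; split; apply/eqP => eq_phi.
    have := phiA (phi x) pA; rewrite ppx => -[_ _ _].
    have := congr1 phi eq_phi; rewrite ppy ppx => eq_y.
    by rewrite eq_y ppx eqxx in y2.
  by move: y1; rewrite -eq_phi ppy eqxx.
rewrite {1}eqA set_detU; last first.
  move=> y z; rewrite !inE => yx /and3P[z1 z2 zA].
  by case/orP: yx => /eqP->; apply: F0; rewrite ?ppx // eq_sym.
rewrite -seq_det_set ?cA //=; last by rewrite inE eq_sym pNx.
rewrite cardA /= exprS; congr (_ * _); apply: IHm.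
- by rewrite cardA in leAm; apply: ltnW.
- move=> y yB; split; first exact: phiB.
    by case: (phiA y) => //; move: yB; rewrite !inE => /and3P[].
  by case: (phiA y) => //; move: yB; rewrite !inE => /and3P[].
- by move=> y; rewrite !inE => /and3P[_ _ yA]; apply: cA.
by move=> y z; rewrite !inE => /and3P[_ _ yA] /and3P[_ _ zA]; apply: F0.
Qed.

End SetDet.

(** * The characteristic polynomial of a path *)

(** The Chebyshev polynomial of the second kind U_m(X/2). *)
Fixpoint path_poly (K : nzRingType) (m : nat) : {poly K} :=
  if m is m1.+1 then
    if m1 is m2.+1 then 'X * path_poly K m1 - path_poly K m2 else 'X
  else 1.

Lemma path_polySS (K : nzRingType) m :
  path_poly K m.+2 = 'X * path_poly K m.+1 - path_poly K m.
Proof. by []. Qed.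

(** The recurrence goes back two steps, so the induction carries two
    consecutive values. *)
Lemma monic_path_poly (K : nzRingType) m :
  path_poly K m \is monic /\ size (path_poly K m) = m.+1.
Proof.
suff [] : (path_poly K m \is monic /\ size (path_poly K m) = m.+1) /\
  (path_poly K m.+1 \is monic /\ size (path_poly K m.+1) = m.+2) by [].
elim: m => [|m [[mon0 sz0] [mon1 sz1]]].
  by rewrite monic1 monicX size_poly1 size_polyX.
split=> //; have szX : size ('X * path_poly K m.+1) = m.+3.
  by rewrite size_monicM ?monicX ?monic_neq0 // size_polyX sz1.
have lt_sz : (size (- path_poly K m)%R < size ('X * path_poly K m.+1)%R)%N.
  by rewrite size_polyN sz0 szX.
rewrite path_polySS size_polyDl // szX; split=> //.
by rewrite monicE lead_coefDl // -monicE monicMl // monicX.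
Qed.

Section Cosines.
Variable R : realType.

(** Both sides satisfy the same recurrence, by
    sin ((m+3)x) + sin ((m+1)x) = 2 cos x sin ((m+2)x). *)
Lemma path_poly_sin m (x : R) :
  sin x * (path_poly R m).[2 * cos x] = sin (x *+ m.+1).
Proof.
suff [] : sin x * (path_poly R m).[2 * cos x] = sin (x *+ m.+1) /\
  sin x * (path_poly R m.+1).[2 * cos x] = sin (x *+ m.+2) by [].
elim: m => [|m [IH0 IH1]].
  rewrite mulr1n mulr2n sinD /= hornerX hornerC; split; ring.
split=> //; rewrite path_polySS hornerD hornerN hornerM hornerX.
rewrite mulrBr IH0 mulrCA IH1.
have -> : x *+ m.+3 = x *+ m.+2 + x by rewrite mulrSr.
have -> : x *+ m.+1 = x *+ m.+2 - x by rewrite (mulrSr x m.+1) addrK.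
(* x *+ m.+2 unfolds, and ring would see its definition. *)
move: (x *+ m.+2) => a; rewrite sinB sinD; ring.
Qed.

(** The angles pi k / (m+1) lie strictly between 0 and pi, where sin does not
    vanish and cos is injective; so [path_poly_sin] makes the listed numbers m
    distinct roots of a monic polynomial of degree m. *)
Lemma path_poly_factor m :
  path_poly R m =
    \prod_(x <- [seq 2 * cos (pi * k%:R / m.+1%:R) : R | k <- iota 1 m])
       ('X - x%:P).
Proof.
set rs := map _ _.
have [mon sz] := monic_path_poly R m.
have m1_gt0 : 0 < m.+1%:R :> R by rewrite ltr0n.
have angle k : k \in iota 1 m -> 0 < (pi * k%:R / m.+1%:R : R) < pi.
  rewrite mem_iota add1n => /andP[k0 km].
  rewrite divr_gt0 ?mulr_gt0 ?pi_gt0 ?ltr0n //=.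
  by rewrite ltr_pdivrMr // ltr_pM2l ?pi_gt0 // ltr_nat.
rewrite [LHS](@all_roots_prod_XsubC _ _ rs).
- by rewrite (monicP mon) scale1r.
- by rewrite sz size_map size_iota.
- apply/allP=> _ /mapP[k k_in ->]; rewrite rootE.
  have ak := angle k k_in.
  have sin_neq0 : sin (pi * k%:R / m.+1%:R) != 0 :> R.
    by rewrite gt_eqF // sin_gt0_pi.
  rewrite -(mulrI_eq0 _ (mulfI sin_neq0)) path_poly_sin.
  have -> : (pi * k%:R / m.+1%:R) *+ m.+1 = pi *+ k :> R.
    by rewrite -[LHS]mulr_natr divfK ?gt_eqF // mulr_natr.
  elim: k {k_in ak sin_neq0} => [|k IHk]; first by rewrite sin0.
  by rewrite mulrSr sinDpi oppr_eq0.
rewrite uniq_rootsE map_inj_in_uniq ?iota_uniq // => k l k_in l_in /=.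
move/(mulfI (_ : 2 != 0)); rewrite pnatr_eq0 => /(_ isT) eq_cos.
have /andP[k0 k1] := angle k k_in; have /andP[l0 l1] := angle l l_in.
have := cos_inj _ _ eq_cos; rewrite !in_itv /= !ltW // => /(_ isT isT).
move/(mulIf (_ : m.+1%:R^-1 != 0)); rewrite invr_eq0 gt_eqF // => /(_ isT).
move/(mulfI (_ : pi != 0)); rewrite gt_eqF ?pi_gt0 // => /(_ isT) /eqP.
by rewrite eqr_nat => /eqP.
Qed.

End Cosines.

(** * The graph on the parts of a path of edges *)

Section PathGraph.
Variables (V : finType) (n : nat) (P : nat -> {set V}).
Hypothesis P_ex : forall i, (i <= n)%N -> exists v, v \in P i.
Hypothesis P_uniq : forall v i j, v \in P i -> v \in P j -> i = j.

Definition link (i : nat) : {set V} := P i :|: P i.+1.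

Definition proper_part (e A : {set V}) : bool :=
  [&& A \subset e, A != set0 & A != e].

(** The relation holds when {A, B} is a 2-partition of some edge; this form
    makes B a function of A and of the index of the edge. *)
Definition adj (A B : {set V}) : bool :=
  [exists i : 'I_n, proper_part (link i) A && (B == link i :\: A)].

Definition splits (A : {set V}) (k : nat) : bool :=
  [exists v in P k, exists w in P k, (v \in A) && (w \notin A)].

Lemma proper_partP (e A : {set V}) :
  reflect (exists v w, [/\ A \subset e, v \in A, w \in e & w \notin A])
          (proper_part e A).
Proof.
apply: (iffP and3P) => [[sAe /set0Pn[v vA] neqAe] | [v [w [sAe vA we wA]]]].
  have : A \proper e by rewrite properEneq neqAe.
  by case/properP => _ [w we wA]; exists v, w.
split=> //; first by apply/set0Pn; exists v.
by apply: contraNneq wA => ->.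
Qed.

Lemma setDDsub (e A : {set V}) : A \subset e -> e :\: (e :\: A) = A.
Proof. by move=> sAe; rewrite setDDr setDv set0U; apply/setIidPr. Qed.

Lemma proper_partC e A : proper_part e A -> proper_part e (e :\: A).
Proof.
case/proper_partP=> v [w [sAe vA we wA]]; apply/proper_partP.
by exists w, v; rewrite subsetDl !inE wA we vA (subsetP sAe).
Qed.

Lemma splitsP (A : {set V}) k :
  reflect (exists v w, [/\ v \in P k, w \in P k, v \in A & w \notin A])
          (splits A k).
Proof.
apply: (iffP exists_inP) => [[v vP /exists_inP[w wP /andP[vA wA]]]|].
  by exists v, w.
case=> v [w [vP wP vA wA]]; exists v => //.
by apply/exists_inP; exists w; rewrite // vA.
Qed.

Lemma splitsPn (A : {set V}) k : ~~ splits A k ->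
  (forall v, v \in P k -> v \in A) \/ (forall v, v \in P k -> v \notin A).
Proof.
move=> nsp; case: (boolP [exists v in P k, v \in A]) => [/exists_inP[v vP vA]|].
  left=> w wP; apply: contraNT nsp => wA; apply/splitsP; by exists v, w.
by rewrite negb_exists_in => /forall_inP; right.
Qed.

Lemma link_index v i k : v \in link i -> v \in P k -> k = i \/ k = i.+1.
Proof.
by rewrite inE => /orP[] v1 v2; rewrite (P_uniq v1 v2); [left|right].
Qed.

Lemma linkP (v : V) i k : v \in P k -> (v \in link i) = (k == i) || (k == i.+1).
Proof.
move=> vk; apply/idP/orP; first by move/link_index/(_ vk) => -[->|->];
  [left|right].
by rewrite inE => -[] /eqP <-; rewrite vk ?orbT.
Qed.

Lemma adjP A B :
  reflect (exists i, [/\ (i < n)%N, proper_part (link i) A & B = link i :\: A])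
          (adj A B).
Proof.
apply: (iffP existsP) => [[i /andP[pA /eqP->]]|[i [lt_in pA ->]]].
  by exists i.
by exists (Ordinal lt_in); rewrite pA eqxx.
Qed.

Lemma adj_sym A B : adj A B = adj B A.
Proof.
suff imp C D : adj C D -> adj D C by apply/idP/idP; apply: imp.
case/adjP=> i [lt_in pC ->]; apply/adjP; exists i; split=> //.
  exact: proper_partC.
by rewrite setDDsub //; case/and3P: pC.
Qed.

Lemma adj_irrefl A : adj A A = false.
Proof.
apply/negbTE/negP => /adjP[i [_ /proper_partP[v [_ [_ vA _ _]]] eqA]].
by have := vA; rewrite {1}eqA inE vA.
Qed.

(** Passing from A to its complement in an edge exchanges the vertices of P k
    inside and outside A if P k lies in the edge, and the edge is disjoint from
    P k otherwise. *)
Lemma adj_splits A B k : adj A B -> splits A k = splits B k.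
Proof.
suff imp C D : adj C D -> splits C k -> splits D k.
  by move=> aAB; apply/idP/idP; apply: imp; rewrite // adj_sym.
case/adjP=> i [lt_in pC ->] /splitsP[v [w [vk wk vC wC]]].
apply/splitsP; exists w, v; rewrite !inE vC wC -!in_setU; split=> //=.
have vi : v \in link i by case/and3P: pC => /subsetP/(_ v vC).
by rewrite -/(link i) (linkP i wk) -(linkP i vk).
Qed.

Lemma splits_P i k : splits (P i) k = false.
Proof.
apply/negbTE/negP => /splitsP[v [w [vk wk vi wi]]].
by rewrite -(P_uniq vk vi) wk in wi.
Qed.

Lemma P_inj i j : (i <= n)%N -> P i = P j -> i = j.
Proof. by case/P_ex=> v vi eqP; apply: (@P_uniq v); rewrite -?eqP. Qed.

Lemma proper_P i j : (j <= n)%N -> (i < n)%N ->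
  proper_part (link i) (P j) = (j == i) || (j == i.+1).
Proof.
move=> le_jn lt_in; have [v vj] := P_ex le_jn; rewrite -(linkP i vj).
apply/idP/idP => [/and3P[/subsetP sub _ _]|]; first exact: sub.
case/link_index/(_ vj)=> eqj; apply/proper_partP.
  have [w w1] := P_ex lt_in; exists v, w; split=> //.
  - by rewrite eqj subsetUl.
  - by rewrite inE w1 orbT.
  by apply/negP => wj; have := P_uniq w1 wj; lia.
have [w w1] := P_ex (ltnW lt_in); exists v, w; split=> //.
- by rewrite eqj subsetUr.
- by rewrite inE w1.
by apply/negP => wj; have := P_uniq w1 wj; lia.
Qed.

Lemma linkDl i : link i :\: P i = P i.+1.
Proof.
apply/setP=> v; rewrite !inE; case: (boolP (v \in P i)) => //= vi.
by apply/esym/negbTE/negP => vi1; have := P_uniq vi vi1; lia.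
Qed.

Lemma linkDr i : link i :\: P i.+1 = P i.
Proof.
rewrite -[in LHS](linkDl i) setDDsub //; exact: subsetUl.
Qed.

Lemma adj_P i j : (i <= n)%N -> (j <= n)%N ->
  adj (P i) (P j) = (j == i.+1) || (i == j.+1).
Proof.
move=> le_in le_jn; apply/adjP/orP => [[k [lt_kn]]|].
  rewrite proper_P // => /orP[] /eqP->.
    by rewrite linkDl => /(P_inj le_jn) ->; left.
  by rewrite linkDr => /(P_inj le_jn) ->; right.
case=> /eqP eq_ij; rewrite eq_ij in le_in le_jn *.
  by exists i; rewrite proper_P ?eqxx ?linkDl.
by exists j; rewrite proper_P ?eqxx ?orbT ?linkDr.
Qed.

Definition doubly_split (i : nat) : {set {set V}} :=
  [set A : {set V} | [&& A \subset link i, splits A i & splits A i.+1]].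

Lemma proper_doubly_split i A : A \in doubly_split i -> proper_part (link i) A.
Proof.
rewrite inE => /and3P[sA /splitsP[v [w [vi wi vA wA]]] _].
by apply/proper_partP; exists v, w; rewrite sA !inE wi.
Qed.

(** A meets both P i and P i.+1, so no other edge contains it. *)
Lemma adj_doubly_split i A B : (i < n)%N -> A \in doubly_split i ->
  adj A B = (B == link i :\: A).
Proof.
move=> lt_in Ai; have pA := proper_doubly_split Ai.
apply/adjP/eqP => [[j [lt_jn /and3P[/subsetP sA _ _] ->]]|->]; last by exists i.
move: Ai; rewrite inE => /and3P[_ /splitsP[v [_ [vi _ vA _]]]].
case/splitsP=> v' [_ [vi' _ vA' _]].
have := link_index (sA v vA) vi; have := link_index (sA v' vA') vi'.
by move=> h1 h2; have -> : j = i by lia.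
Qed.

Lemma doubly_splitC i A : (i < n)%N -> A \in doubly_split i ->
  link i :\: A \in doubly_split i.
Proof.
move=> lt_in Ai; have adjA : adj A (link i :\: A).
  by rewrite (adj_doubly_split _ lt_in Ai).
by move: Ai; rewrite !inE -!(adj_splits _ adjA) subsetDl => /and3P[_ -> ->].
Qed.

Definition proper_subsets (j : nat) : {set {set V}} :=
  [set A | proper_part (P j) A].

(** The indices of the edges that contain P j: j - 1 and j, except at the two
    ends of the path. *)
Definition links_at (j : nat) : seq nat :=
  (if j is j1.+1 then [:: j1] else [::]) ++
  (if (j < n)%N then [:: j] else [::]).

Definition leaves (j : nat) (A : {set V}) :=
  [seq link i :\: A | i <- links_at j].

Lemma mem_links_at j i : (j <= n)%N ->
  (i \in links_at j) = (i < n)%N && ((j == i) || (j == i.+1)).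
Proof.
case: j => [|j] le_jn; rewrite /links_at; case: ifP; rewrite /= ?inE ?in_nil;
  lia.
Qed.

Lemma proper_subset_link j A i : A \in proper_subsets j -> (j <= n)%N ->
  (i < n)%N -> proper_part (link i) A = (j == i) || (j == i.+1).
Proof.
rewrite inE => /proper_partP[v [w [/subsetP sA vA wj wA]]] le_jn lt_in.
have vj := sA v vA; rewrite -(linkP i vj).
apply/idP/idP => [/and3P[/subsetP sub _ _]|vi]; first exact: sub.
apply/proper_partP; exists v, w; split=> //;
  last by rewrite (linkP i wj) -(linkP i vj).
apply/subsetP=> u /sA uj; by rewrite (linkP i uj) -(linkP i vj).
Qed.

Lemma adj_proper_subset j A B : (j <= n)%N -> A \in proper_subsets j ->
  adj A B = (B \in leaves j A).
Proof.
move=> le_jn jA; apply/adjP/mapP => [[i [lt_in]]|[i]].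
  rewrite (proper_subset_link jA) // => ji ->; exists i => //.
  by rewrite mem_links_at // lt_in.
rewrite mem_links_at // => /andP[lt_in ji] ->; exists i.
by rewrite (proper_subset_link jA).
Qed.

Lemma splits_proper_subset j A k : A \in proper_subsets j ->
  splits A k = (k == j).
Proof.
rewrite inE => /proper_partP[v [w [/subsetP sA vA wj wA]]].
apply/splitsP/eqP => [[u [_ [uk _ uA _]]]|->]; last by exists v, w; rewrite sA.
exact: P_uniq uk (sA u uA).
Qed.

(** A leaf meets P j and also the other part of its edge; hence it is contained
    in no other edge and is not a subset of P j. *)
Lemma leafP j A B : (j <= n)%N -> A \in proper_subsets j -> B \in leaves j A ->
  exists i, [/\ (i < n)%N, (j == i) || (j == i.+1), B = link i :\: A,
    (exists2 w, w \in P j & w \in B) &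
    (exists k u, [/\ ((k == i) || (k == i.+1)), k != j, u \in P k & u \in B])].
Proof.
move=> le_jn jA /mapP[i]; rewrite mem_links_at // => /andP[lt_in ji] ->.
exists i; split=> //.
  move: jA; rewrite inE => /proper_partP[_ [w [_ _ wj wA]]].
  by exists w; rewrite // inE wA (linkP i wj).
have [k [le_kn ki kj]] :
    exists k, [/\ (k <= n)%N, (k == i) || (k == i.+1) & k != j].
  by case/orP: ji => /eqP ->; [exists i.+1 | exists i]; split; lia.
have [u uk] := P_ex le_kn; exists k, u; split=> //.
rewrite inE (linkP i uk) ki andbT; apply: contraNN kj => uA.
move: jA; rewrite inE => /and3P[/subsetP/(_ u uA) uj _ _].
by rewrite (P_uniq uk uj).
Qed.

Lemma adj_leaf j A B C : (j <= n)%N -> A \in proper_subsets j ->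
  B \in leaves j A -> adj B C = (C == A).
Proof.
move=> le_jn jA lfB; apply/idP/eqP => [|->];
  last by rewrite adj_sym (adj_proper_subset _ le_jn).
have [i [lt_in ji eqB [w wj wB] [k [u [ki kj uk uB]]]]] := leafP le_jn jA lfB.
case/adjP=> i' [lt_in' /and3P[/subsetP sB _ _] ->].
have h1 := link_index (sB w wB) wj; have h2 := link_index (sB u uB) uk.
have -> : i' = i by lia.
rewrite eqB setDDsub //.
by move: ji; rewrite -(proper_subset_link jA) // => /and3P[].
Qed.

Lemma leaf_not_sub j A B : (j <= n)%N -> A \in proper_subsets j ->
  B \in leaves j A -> (B \subset P j) = false.
Proof.
move=> le_jn jA lfB; have [i [_ _ _ _ [k [u [_ kj uk uB]]]]] :=
  leafP le_jn jA lfB.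
apply/negbTE/negP => /subsetP/(_ u uB) uj; by rewrite (P_uniq uk uj) eqxx in kj.
Qed.

(** The index j is recovered from B as the only part that B splits.  The centre
    of the star is then B itself if B is a subset of P j, and the only
    neighbour of B otherwise. *)
Lemma star_disjoint j j' A A' B : (j <= n)%N -> (j' <= n)%N ->
  A \in proper_subsets j -> A' \in proper_subsets j' ->
  B \in A :: leaves j A -> B \in A' :: leaves j' A' -> j = j' /\ A = A'.
Proof.
move=> le_jn le_jn' jA jA'.
have star_splits i C : (i <= n)%N -> C \in proper_subsets i ->
    B \in C :: leaves i C -> splits B i /\ forall k, splits B k -> k = i.
  move=> le_in iC; rewrite inE => BC.
  suff spB k : splits B k = (k == i).
    by rewrite spB; split=> // k; rewrite spB => /eqP.
  case/predU1P: BC => [->|lfB]; first exact: splits_proper_subset.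
  rewrite -(splits_proper_subset _ iC); apply: adj_splits.
  by rewrite (adj_leaf _ le_in iC lfB).
move=> BA BA'.
have eqj : j = j'.
  have [spj _] := star_splits _ _ le_jn jA BA.
  by have [_] := star_splits _ _ le_jn' jA' BA'; apply.
subst j'; split=> //.
have sub C : C \in proper_subsets j -> C \subset P j by rewrite inE => /and3P[].
move: BA BA'; rewrite !inE => /predU1P[->|lfB] /predU1P[].
- by [].
- by move/(leaf_not_sub le_jn jA'); rewrite sub.
- by move=> eqB; move: (leaf_not_sub le_jn jA lfB); rewrite eqB sub.
move=> lfB'; apply/eqP; rewrite -(adj_leaf _ le_jn jA' lfB').
by rewrite (adj_leaf _ le_jn jA lfB).
Qed.

Lemma star_closed j A B C : (j <= n)%N -> A \in proper_subsets j ->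
  B \in A :: leaves j A -> adj B C -> C \in A :: leaves j A.
Proof.
move=> le_jn jA; rewrite !inE => /predU1P[->|lfB].
  by rewrite (adj_proper_subset _ le_jn jA) => ->; rewrite orbT.
by rewrite (adj_leaf _ le_jn jA lfB) => ->.
Qed.

(** Two leaves of the same star lie in different edges since each meets a part
    other than P j. *)
Lemma star_uniq j A : (j <= n)%N -> A \in proper_subsets j ->
  uniq (A :: leaves j A).
Proof.
move=> le_jn jA /=; apply/andP; split.
  by rewrite -(adj_proper_subset _ le_jn jA) adj_irrefl.
rewrite map_inj_in_uniq.
  by rewrite /links_at; case: (j) => [|k] /=; case: ifP => //= _;
    rewrite inE andbT; lia.
move=> i i' iA iA' eq_i.
have lfi : link i :\: A \in leaves j A by apply: map_f.
have [_ [_ _ _ _ [k [u [_ kj uk uB]]]]] := leafP le_jn jA lfi.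
have := uB; rewrite eq_i in_setD => /andP[_ ui'].
have := uB; rewrite in_setD => /andP[_ ui].
move: iA iA'; rewrite !mem_links_at // => h h'.
have := link_index ui uk; have := link_index ui' uk; lia.
Qed.

(** If A splits P k but not the other part P l of its edge, then A contains P l
    or is disjoint from it; accordingly A is a leaf or the centre of a star. *)
Lemma proper_part_cases i A : (i < n)%N -> proper_part (link i) A ->
  [\/ exists2 k, (k <= n)%N & A = P k,
      exists k B,
        [/\ (k <= n)%N, B \in proper_subsets k & A \in B :: leaves k B] |
      A \in doubly_split i].
Proof.
move=> lt_in pA; have sA : A \subset link i by case/and3P: pA.
have star_case k l : (k <= n)%N -> (k == i) || (k == i.+1) ->
    link i = P k :|: P l -> splits A k -> ~~ splits A l ->
    exists k B, [/\ (k <= n)%N, B \in proper_subsets k & A \in B :: leaves k B].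
  move=> le_kn ki eq_link /splitsP[v [w [vk wk vA wA]]] nspl.
  have inkl u : u \in link i -> u \in P k \/ u \in P l.
    by rewrite eq_link inE => /orP.
  have [Pl|Pl] := splitsPn nspl.
    exists k, (link i :\: A); split=> //.
      rewrite inE; apply/proper_partP; exists w, v; split=> //.
      - apply/subsetP=> u; rewrite inE => /andP[uA /inkl[//|/Pl]].
        by rewrite (negPf uA).
      - by rewrite inE wA (linkP i wk).
      by rewrite inE vA.
    rewrite inE; apply/orP; right; apply/mapP; exists i.
      by rewrite mem_links_at // lt_in.
    by rewrite setDDsub.
  exists k, A; split; rewrite ?mem_head //.
  rewrite inE; apply/proper_partP; exists v, w; split=> //.
  by apply/subsetP=> u uA; case: (inkl u (subsetP sA u uA)) => // /Pl;
    rewrite uA.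
case: (boolP (splits A i)) => spi; case: (boolP (splits A i.+1)) => spi1.
- by apply: Or33; rewrite inE sA spi.
- by apply: Or32; apply: (star_case i i.+1); rewrite ?eqxx // ltnW.
- by apply: Or32; apply: (star_case i.+1 i); rewrite ?eqxx ?orbT // setUC.
apply: Or31; case/and3P: pA => _ A0 Ae.
have sA' u : u \in A -> u \in P i \/ u \in P i.+1.
  by move/(subsetP sA); rewrite inE => /orP.
have [Pi|Pi] := splitsPn spi; have [Pi1|Pi1] := splitsPn spi1.
- by case/eqP: Ae; apply/eqP; rewrite eqEsubset sA; apply/subsetP=> u;
    rewrite inE => /orP[/Pi|/Pi1].
- exists i; first exact: ltnW.
  apply/setP=> u; apply/idP/idP=> [uA|/Pi //].
  by case: (sA' u uA) => // /Pi1; rewrite uA.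
- exists i.+1 => //; apply/setP=> u; apply/idP/idP=> [uA|/Pi1 //].
  by case: (sA' u uA) => // /Pi; rewrite uA.
by case/set0Pn: A0 => u uA; case: (sA' u uA) => [/Pi|/Pi1]; rewrite uA.
Qed.

End PathGraph.

Lemma card_proper_part (V : finType) (e : {set V}) : e != set0 ->
  #|[set A : {set V} | proper_part e A]| = (2 ^ #|e| - 2)%N.
Proof.
move=> e0; have -> : [set A | proper_part e A] = powerset e :\ e :\ set0.
  by apply/setP=> A; rewrite !inE /proper_part; case: (A \subset e);
    rewrite ?andbF ?andbT.
have := cardsD1 e (powerset e); have := cardsD1 set0 (powerset e :\ e).
rewrite !inE subxx sub0set eq_sym e0 card_powerset /=; lia.
Qed.

(** * The determinant of the graph on the parts *)

Section PathDet.
Variables (V : finType) (n : nat) (P : nat -> {set V}).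
Hypothesis P_ex : forall i, (i <= n)%N -> exists v, v \in P i.
Hypothesis P_uniq : forall v i j, v \in P i -> v \in P j -> i = j.

Lemma card_proper_subsets j : (j <= n)%N ->
  #|proper_subsets P j| = (2 ^ #|P j| - 2)%N.
Proof.
by case/P_ex=> v vj; rewrite card_proper_part //; apply/set0Pn; exists v.
Qed.

(** A set A in e_i is determined by its traces on P i and P i.+1, which are
    arbitrary non-empty proper subsets. *)
Lemma card_doubly_split i : (i < n)%N ->
  #|doubly_split P i| = ((2 ^ #|P i| - 2) * (2 ^ #|P i.+1| - 2))%N.
Proof.
move=> lt_in; rewrite -!card_proper_subsets // ?(ltnW lt_in) //.
rewrite -cardsX; pose U (X : {set V} * {set V}) := X.1 :|: X.2.
have trace (B C : {set V}) : B \subset P i -> C \subset P i.+1 ->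
    (B :|: C) :&: P i = B /\ (B :|: C) :&: P i.+1 = C.
  move=> /subsetP sB /subsetP sC; split; apply/setP=> v; rewrite !inE.
    case: (boolP (v \in C)) => [/sC v1|_]; last first.
      by rewrite orbF; case: (boolP (v \in B)) => [/sB|].
    by case: (boolP (v \in P i)) => [vi|vi]; [have := P_uniq v1 vi; lia|];
       rewrite andbF; apply/esym/negbTE; apply: contraNN vi => /sB.
  case: (boolP (v \in B)) => [/sB vi|_]; last first.
    by rewrite /=; case: (boolP (v \in C)) => [/sC|].
  by case: (boolP (v \in P i.+1)) => [v1|v1]; [have := P_uniq v1 vi; lia|];
     rewrite andbF; apply/esym/negbTE; apply: contraNN v1 => /sC.
have sub k A : A \in proper_subsets P k -> A \subset P k.
  by rewrite inE => /and3P[].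
rewrite -(@card_in_imset _ _ U); last first.
  move=> [B C] [B' C']; rewrite !inE /= => /andP[/and3P[sB _ _] /and3P[sC _ _]].
  move=> /andP[/and3P[sB' _ _] /and3P[sC' _ _]]; rewrite /U /= => eqU.
  have := trace B C sB sC; have := trace B' C' sB' sC'.
  by rewrite -eqU => -[-> ->] [-> ->].
apply: eq_card => A; apply/idP/imsetP => [|[[B C]]].
  rewrite inE => /and3P[/subsetP sA /splitsP[v [w [vi wi vA wA]]]].
  case/splitsP=> v' [w' [vi' wi' vA' wA']].
  exists (A :&: P i, A :&: P i.+1); last first.
    by rewrite /U /= -setIUr; apply/esym/setIidPl/subsetP.
  rewrite !inE /=; apply/andP; split; apply/proper_partP.
    by exists v, w; rewrite subsetIr !inE vA vi wi (negPf wA).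
  by exists v', w'; rewrite subsetIr !inE vA' vi' wi' (negPf wA').
rewrite in_setX /= => /andP[iB iC] ->; rewrite inE /U /=.
have sB := sub _ _ iB; have sC := sub _ _ iC.
have [eB eC] := trace B C sB sC.
rewrite setUSS //=.
move: iB iC; rewrite !inE => /proper_partP[v [w [_ vB wi wB]]].
move=> /proper_partP[v' [w' [_ vC wi' wC]]].
rewrite -{1}eB inE in vB; rewrite -eB inE wi andbT in wB.
rewrite -{1}eC inE in vC; rewrite -eC inE wi' andbT in wC.
case/andP: vB => vB vi; case/andP: vC => vC vi'.
by apply/andP; split; apply/splitsP; [exists v, w | exists v', w'].
Qed.

Variable R : comNzRingType.

(** The entries of the matrix X - M, where M is the adjacency matrix. *)
Definition weight (A B : {set V}) : {poly R} :=
  'X *+ (A == B) - (adj n P A B)%:R.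

Lemma weight_diag A : weight A A = 'X.
Proof. by rewrite /weight eqxx adj_irrefl subr0. Qed.

Lemma weight_diag_neq0 A : weight A A != 0.
Proof. by rewrite weight_diag polyX_eq0. Qed.

Lemma weight_adj A B : adj n P A B -> weight A B = -1.
Proof.
rewrite /weight; case: eqP => [->|_ ->]; first by rewrite adj_irrefl.
by rewrite sub0r.
Qed.

Lemma weight_eq0 A B : A != B -> ~~ adj n P A B -> weight A B = 0.
Proof. by rewrite /weight => /negPf-> /negPf->; rewrite subr0. Qed.

Lemma seq_det_edge A B : adj n P A B -> seq_det weight [:: A; B] = 'X ^+ 2 - 1.
Proof.
move=> aAB; rewrite seq_det_cons2 // seq_det1 seq_det_nil !weight_diag.
by rewrite !weight_adj // 1?adj_sym // mulrNN !mulr1 expr2.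
Qed.

(** Each P k is joined only to P k.+1 among the later parts, so that
    [seq_det_cons2] reproduces the recurrence of [path_poly]. *)
Lemma seq_det_path :
  seq_det weight [seq P i | i <- iota 0 n.+1] = path_poly R n.+1.
Proof.
suff path_from m k : (k + m <= n.+1)%N ->
    seq_det weight [seq P i | i <- iota k m] = path_poly R m.
  exact: path_from.
have [b] := ubnP m; elim: b m k => // b IHb [|[|m]] k;
  rewrite ltnS => le_mb le_kn.
- exact: seq_det_nil.
- by rewrite seq_det1 weight_diag.
rewrite path_polySS -(IHb _ k.+1) -?(IHb _ k.+2); try lia.
rewrite [iota k m.+2]/= [iota k.+1 m.+1]/= !map_cons seq_det_cons2.
  by rewrite weight_diag !weight_adj ?mulrNN ?mul1r // adj_P // ?eqxx ?orbT //;
    lia.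
have far i j : (i <= n)%N -> (j <= n)%N -> (i.+1 < j)%N || (j.+1 < i)%N ->
    weight (P i) (P j) = 0.
  move=> le_in le_jn lt_ij; apply: weight_eq0; last by rewrite adj_P //; lia.
  by apply: contraTneq lt_ij => /(P_inj P_ex P_uniq le_in); lia.
move=> _ /mapP[i i_in ->]; move: i_in; rewrite mem_iota => i_in.
by split; apply: far; lia.
Qed.

(** The characteristic polynomial of the star with as many leaves as there are
    edges at P j. *)
Definition star_poly (j : nat) : {poly R} :=
  if (j == 0)%N || (j == n) then 'X ^+ 2 - 1 else 'X ^+ 3 - 'X *+ 2.

Lemma seq_det_star j A : (0 < n)%N -> (j <= n)%N -> A \in proper_subsets P j ->
  seq_det weight (A :: leaves n P j A) = star_poly j.
Proof.
move=> n_gt0 le_jn jA.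
have adjA B : B \in leaves n P j A -> adj n P A B.
  by rewrite (adj_proper_subset P_uniq _ le_jn jA).
have := star_uniq P_ex P_uniq le_jn jA.
have := @adj_leaf _ _ _ P_ex P_uniq j A _ _ le_jn jA.
rewrite /star_poly; move: adjA; rewrite /leaves /links_at.
case: j le_jn jA => [|j] le_jn jA /=.
  by rewrite n_gt0 /= => adjA _ _; apply: seq_det_edge; apply: adjA;
    apply: mem_head.
case: (ltngtP j.+1 n) => [lt_jn|gt_jn|eq_jn] /=; last first;
  [ | by rewrite ltnNge le_jn in gt_jn | ].
  by move=> adjA _ _; apply: seq_det_edge; apply: adjA; apply: mem_head.
set B := link P j :\: A; set C := link P j.+1 :\: A.
move=> adjA adj_lf; rewrite !inE !negb_or !andbT => /andP[/andP[AB AC] BC].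
have aAB : adj n P A B by apply: adjA; rewrite !inE eqxx.
have aAC : adj n P A C by apply: adjA; rewrite !inE eqxx orbT.
have nBC : ~~ adj n P B C by rewrite adj_lf ?mem_head // eq_sym.
(* With its centre A in the middle, the star is a path of three vertices. *)
rewrite (@seq_det_perm _ _ _ _ [:: B; A; C]); last first.
  by rewrite (perm_catCA [:: A] [:: B] [:: C]).
rewrite seq_det_cons2; last first.
  move=> D; rewrite inE => /eqP->; split; apply: weight_eq0 => //.
    by rewrite eq_sym.
  by rewrite adj_sym.
rewrite seq_det_edge // seq_det1 !weight_diag !weight_adj // 1?adj_sym //.
by rewrite mulrNN; ring.
Qed.

Lemma set_det_doubly_split i : (i < n)%N ->
  seq_det weight (enum (doubly_split P i)) =
    ('X ^+ 2 - 1) ^+ (((2 ^ #|P i| - 2) * (2 ^ #|P i.+1| - 2))./2).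
Proof.
move=> lt_in; rewrite -card_doubly_split //.
have adjZ A B : A \in doubly_split P i -> adj n P A B = (B == link P i :\: A).
  exact: adj_doubly_split.
apply: (set_det_involution weight_diag_neq0 (phi := fun A => link P i :\: A)).
- move=> A Ai; split; first exact: (doubly_splitC P_uniq lt_in).
    by rewrite setDDsub //; move: Ai; rewrite inE => /and3P[].
  apply/eqP => eqA; have := adj_irrefl n P A.
  by rewrite (adjZ _ _ Ai) eqA eqxx.
- by move=> A Ai; apply: seq_det_edge; rewrite adjZ.
move=> A B Ai Bi neqAB neqB; apply: weight_eq0; first by rewrite eq_sym.
by rewrite adj_sym adjZ.
Qed.

Definition path_parts : {set {set V}} :=
  [set A : {set V} | [exists i : 'I_n, proper_part (link P i) A]].

Lemma weight_neq0_splits A B k : weight A B != 0 -> splits P A k = splits P B k.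
Proof.
have [-> // | neqAB] := eqVneq A B.
case: (boolP (adj n P A B)) => [aAB _|naAB];
  first exact: (adj_splits P_uniq _ aAB).
by rewrite weight_eq0 ?eqxx.
Qed.

Lemma splits_star j A B k : (j <= n)%N -> A \in proper_subsets P j ->
  B \in A :: leaves n P j A -> splits P B k = (k == j).
Proof.
move=> le_jn jA; rewrite inE -(splits_proper_subset P_uniq _ jA).
case/predU1P=> [->//|lfB]; rewrite -(@adj_splits _ n _ P_uniq A B) //.
by rewrite (adj_proper_subset P_uniq _ le_jn jA).
Qed.

(** The path, the stars and the doubly split sets exhaust the graph because
    a proper part of an edge splits zero, one or two of the P k. *)
Lemma path_parts_decomposition : (0 < n)%N ->
  path_parts = [set A in [seq P i | i <- iota 0 n.+1]] :|:
    (\bigcup_(j in 'I_n.+1) \bigcup_(A in proper_subsets P j)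
        [set B in A :: leaves n P j A] :|:
     \bigcup_(i in 'I_n) doubly_split P i).
Proof.
move=> n_gt0; apply/setP=> A; apply/idP/idP.
  rewrite inE => /existsP[i pA].
  rewrite in_setU in_setU; apply/or3P.
  case: (proper_part_cases P_uniq (ltn_ord i) pA) =>
    [[k le_kn ->]|[k [B [le_kn kB AB]]]|Ai].
  - by apply: Or31; rewrite inE map_f // mem_iota.
  - apply: Or32; apply/bigcupP; exists (Ordinal (le_kn : k < n.+1)%N) => //.
    by apply/bigcupP; exists B => //; rewrite inE.
  by apply: Or33; apply/bigcupP; exists i.
rewrite in_setU in_setU => /or3P[].
- rewrite inE => /mapP[k]; rewrite mem_iota => /andP[_ lt_kn] ->.
  rewrite inE; apply/existsP; case: k lt_kn => [|k] lt_kn.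
    by exists (Ordinal n_gt0); rewrite (proper_P P_ex P_uniq).
  have lt_kn' : (k < n)%N by lia.
  by exists (Ordinal lt_kn'); rewrite (proper_P P_ex P_uniq) ?eqxx ?orbT.
- case/bigcupP=> j _ /bigcupP[B jB]; rewrite inE => AB.
  have le_jn : (j <= n)%N by rewrite -ltnS.
  suff [C aAC] : exists C, adj n P A C.
    case/adjP: aAC => i [lt_in pA _]; rewrite inE.
    by apply/existsP; exists (Ordinal lt_in).
  move: AB; rewrite inE => /predU1P[->|lfA]; last first.
    by exists B; rewrite (adj_leaf P_ex P_uniq _ le_jn jB lfA).
  have [l l_in] : exists l, l \in links_at n j.
    rewrite /links_at; case: (j : nat) => [|k]; last by exists k;
      apply: mem_head.
    by rewrite n_gt0; exists 0%N.
  by exists (link P l :\: B); rewrite (adj_proper_subset P_uniq _ le_jn jB);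
    apply: map_f.
case/bigcupP=> i _ Ai; rewrite inE; apply/existsP; exists i.
exact: proper_doubly_split.
Qed.

(** Adjacent sets split the same parts; so there is no adjacency between the
    three kinds of sets, between stars centred in distinct parts or between sets
    doubly split at distinct edges.  Stars centred in the same part are
    separated by [star_closed] and [star_disjoint]. *)
Lemma set_det_path_parts : (0 < n)%N ->
  seq_det weight (enum path_parts) =
    path_poly R n.+1 *
    (\prod_(j < n.+1) star_poly j ^+ (2 ^ #|P j| - 2) *
     \prod_(i < n) ('X ^+ 2 - 1)
       ^+ (((2 ^ #|P i| - 2) * (2 ^ #|P i.+1| - 2))./2)).
Proof.
move=> n_gt0; rewrite path_parts_decomposition //.
have spZ (i : nat) A : A \in doubly_split P i ->
  splits P A i /\ splits P A i.+1.
  by rewrite inE => /and3P[].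
have le_ord (j : 'I_n.+1) : (j <= n)%N by rewrite -ltnS.
rewrite set_detU; [|exact: weight_diag_neq0|]; last first.
  move=> A B; rewrite inE => /mapP[i _ ->].
  have spP k := splits_P P_uniq i k.
  case/setUP => [/bigcupP[j _ /bigcupP[C jC]]|/bigcupP[k _ Bk]].
    rewrite inE => BC; apply: contraTeq isT => /(weight_neq0_splits j).
    by rewrite spP (splits_star _ (le_ord j) jC BC) eqxx.
  apply: contraTeq isT => /(weight_neq0_splits k).
  by rewrite spP (spZ _ _ Bk).1.
rewrite -seq_det_set; last first.
  rewrite map_inj_in_uniq ?iota_uniq // => i j;
    rewrite !mem_iota => /andP[_ ltin] _.
  by apply: (P_inj P_ex P_uniq); rewrite -ltnS.
rewrite seq_det_path; congr (_ * _).
rewrite set_detU; [|exact: weight_diag_neq0|]; last first.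
  move=> A B /bigcupP[j _ /bigcupP[C jC]]; rewrite inE => AC /bigcupP[k _ Bk].
  have spA l := splits_star l (le_ord j) jC AC.
  apply: contraTeq isT => nz.
  have := weight_neq0_splits k nz; have := weight_neq0_splits k.+1 nz.
  by rewrite !spA (spZ _ _ Bk).1 (spZ _ _ Bk).2; lia.
congr (_ * _).
  rewrite set_det_bigcup; [|exact: weight_diag_neq0|]; last first.
    move=> i j A B _ _ neq_ij /bigcupP[C iC]; rewrite inE => AC /bigcupP[D jD].
    rewrite inE => BD; apply: contraNeq neq_ij => /(weight_neq0_splits i).
    rewrite (splits_star _ (le_ord i) iC AC) (splits_star _ (le_ord j) jD BD).
    by rewrite eqxx.
  apply: eq_bigr => j _; rewrite set_det_bigcup; [|exact: weight_diag_neq0|];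
    last first.
    move=> A A' B B' jA jA' neqA; rewrite !inE -!in_cons => BA BA'.
    apply: contraNeq neqA => nz; apply/eqP.
    suff B'A : B' \in A :: leaves n P j A.
      have le_jn := le_ord j.
      by have [] := star_disjoint P_ex P_uniq le_jn le_jn jA jA' B'A BA'.
    have [-> //|neqB] := eqVneq B' B.
    apply: (star_closed P_ex P_uniq (le_ord j) jA BA).
    by apply: contraNT nz => naB; rewrite weight_eq0 // adj_sym.
  rewrite -card_proper_subsets // -prodr_const; apply: eq_bigr => A jA.
  by rewrite -seq_det_set ?(star_uniq P_ex P_uniq) // seq_det_star.
rewrite set_det_bigcup; [|exact: weight_diag_neq0|]; last first.
  move=> i j A B _ _ neq_ij Ai Bj; apply: contraNeq neq_ij => nz.
  have [spi spi1] := spZ _ _ Ai; have [spj spj1] := spZ _ _ Bj.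
  move: spi; rewrite -(weight_neq0_splits i nz) => spi.
  move: spi1; rewrite -(weight_neq0_splits i.+1 nz) => spi1.
  move: Bj; rewrite inE => /and3P[/subsetP sB _ _].
  case/splitsP: spi => v [_ [vi _ /sB vj _]];
    case/splitsP: spi1 => u [_ [ui _ /sB uj _]].
  have := link_index P_uniq vj vi; have := link_index P_uniq uj ui.
  by move=> h1 h2; apply/eqP/val_inj => /=; lia.
by apply: eq_bigr => i _; rewrite set_det_doubly_split.
Qed.

End PathDet.

(** * Two-partitions and the multiplicities *)

Lemma tau_pair (V : finType) (e A B : {set V}) :
  ([set A; B] \in tau e) = proper_part e A && (B == e :\: A).
Proof.
rewrite inE; apply/andP/andP => [[/and3P[/eqP cov triv no0] card2]|[pA /eqP->]].
  have neqAB : A != B by move: card2; rewrite cards2; case: (A != B).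
  have defe : e = A :|: B by rewrite -cov /cover bigcup_setU !big_set1.
  have dAB : [disjoint A & B].
    by apply: (trivIsetP triv); rewrite ?inE ?eqxx ?orbT.
  move: no0; rewrite !inE negb_or ![set0 == _]eq_sym =>
    /andP[/set0Pn[v vA] /set0Pn[w wB]].
  have nAB u : u \in B -> u \notin A.
    by move=> uB; apply/negP => uA; case/pred0Pn: dAB; exists u; apply/andP.
  split.
    by apply/proper_partP; exists v, w;
      rewrite defe subsetUl inE wB orbT vA nAB.
  apply/eqP/setP=> u; rewrite defe !inE; case: (boolP (u \in B)) => [/nAB->|];
    first by rewrite orbT.
  by rewrite orbF andNb.
case/proper_partP: (pA) => v [w [sA vA we wA]].
have neqA : A != e :\: A by apply: contraNneq (wA) => ->; rewrite inE wA we.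
split; last by rewrite cards2 neqA.
apply/and3P; split.
- rewrite /cover bigcup_setU !big_set1; apply/eqP/setP=> u; rewrite !inE.
  by case: (boolP (u \in A)) => //= /(subsetP sA)->.
- apply/trivIsetP => X Y; rewrite !inE => /orP[]/eqP-> /orP[]/eqP->;
    rewrite ?eqxx // => _.
    by rewrite disjoint_sym disjoints_subset; apply/subsetP=> u;
      rewrite !inE => /andP[].
  by rewrite disjoints_subset; apply/subsetP=> u; rewrite !inE => /andP[].
rewrite !inE negb_or ![set0 == _]eq_sym; apply/andP; split; apply/set0Pn.
  by exists v.
by exists w; rewrite inE wA.
Qed.

Lemma mem_tau (V : finType) (e A : {set V}) (Q : {set {set V}}) :
  Q \in tau e -> A \in Q -> Q = [set A; e :\: A] /\ proper_part e A.
Proof.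
move=> Qe AQ; have : #|Q| == 2 by move: Qe; rewrite inE => /andP[].
case/cards2P=> B [C [_ eqQ]].
have [D eqQ'] : exists D, Q = [set A; D].
  move: AQ; rewrite eqQ !inE => /orP[]/eqP->; first by exists C.
  by exists B; rewrite setUC.
by move: Qe; rewrite eqQ' tau_pair => /andP[pA /eqP->].
Qed.

Lemma mem_parts (V : finType) (e A : {set V}) :
  (A \in parts e) = proper_part e A.
Proof.
apply/bigcupP/idP => [[Q Qe AQ]|pA]; first by case: (mem_tau Qe AQ).
by exists [set A; e :\: A]; rewrite ?tau_pair ?pA ?eqxx // !inE eqxx.
Qed.

(** The 2-partitions of e are disjoint pairs which together list the non-empty
    proper subsets of e. *)
Lemma card_tau (V : finType) (e : {set V}) : e != set0 ->
  (#|tau e| * 2 = 2 ^ #|e| - 2)%N.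
Proof.
move=> e0; rewrite -card_proper_part //.
have -> : [set A | proper_part e A] = parts e.
  by apply/setP=> A; rewrite inE mem_parts.
apply/esym/card_uniform_partition.
  by move=> Q; rewrite inE => /andP[_ /eqP].
apply/and3P; split=> //.
  apply/trivIsetP=> Q Q' Qe Qe' neqQ; apply/pred0P=> A;
    apply/negbTE/andP => -[/= AQ AQ'].
  have [eqQ _] := mem_tau Qe AQ; have [eqQ' _] := mem_tau Qe' AQ'.
  by rewrite eqQ eqQ' eqxx in neqQ.
apply/negP; rewrite inE => /andP[/and3P[_ _ no0]]; by rewrite cards0.
Qed.

Lemma sum_inner_binomials a : (0 < a)%N ->
  (\sum_(1 <= l < a) 'C(a, l) = 2 ^ a - 2)%N.
Proof.
case: a => // a _; have := expnDn 1 1 a.+1.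
rewrite big_ord_recl big_ord_recr /= big_add1 big_mkord bin0 binn => ->.
rewrite !exp1n !muln1 (eq_bigr (fun i : 'I_a => 'C(a.+1, i.+1))); last first.
  by move=> i _; rewrite !exp1n !muln1.
by rewrite add1n addn1 subn2.
Qed.

Lemma path_pE (V : finType) n (S : n.+1.-tuple {set V}) i :
  (0 < part_size S i)%N -> (0 < part_size S i.+1)%N ->
  path_p S i.+1 = (((2 ^ part_size S i - 2) * (2 ^ part_size S i.+1 - 2))./2)%N.
Proof.
rewrite /path_p /= => a_gt0 b_gt0.
case: ifP => [/orP[]/eqP->|_]; rewrite ?muln0 //.
congr (_./2); rewrite -!sum_inner_binomials // big_distrl /=.
by apply: eq_bigr => l1 _; rewrite big_distrr.
Qed.

(** This removes the case distinctions on sizes: 2 ^ a - 2 vanishes at a = 1. *)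
Lemma path_tE (V : finType) n (S : n.+1.-tuple {set V}) :
  (forall i, (i <= n)%N -> (0 < part_size S i)%N) ->
  path_t S =
    (\sum_(i < n) ((2 ^ part_size S i - 2) * (2 ^ part_size S i.+1 - 2))./2
     + (2 ^ part_size S 0 - 2) + (2 ^ part_size S n - 2))%N.
Proof.
move=> gt0.
have t1E : path_t1 S =
    (\sum_(i < n) ((2 ^ part_size S i - 2) * (2 ^ part_size S i.+1 - 2))./2)%N.
  rewrite /path_t1 big_add1 big_mkord; apply: eq_bigr => i _.
  by rewrite path_pE // gt0 // ltnW.
have ge2 i : (i <= n)%N -> (2 <= 2 ^ part_size S i)%N.
  by move/gt0; case: part_size => // a _; rewrite expnS leq_pmulr // expn_gt0.
rewrite /path_t -t1E; have := ge2 _ (leq0n n); have := ge2 _ (leqnn n).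
by do 2!case: eqP => [->|_]; lia.
Qed.

(** * The unified matrix of a unified path *)

Section UnifiedPath.
Variables (V : finType) (EP : hypergraph V) (n : nat) (S : n.+1.-tuple {set V}).
Hypothesis n_gt0 : (0 < n)%N.
Hypothesis EP_path : unified_path EP S.

Local Notation P := (nth set0 S).

Lemma unified_path_ex i : (i <= n)%N -> exists v, v \in P i.
Proof.
case/and5P: EP_path => _ /andP[/andP[_ /(sortedP set0) walk] _] _ _ _ le_in.
rewrite size_tuple in walk.
have step j : (j < n)%N -> (exists v, v \in P j) /\ (exists v, v \in P j.+1).
  rewrite -ltnS => /walk /hasP[e _];
    rewrite tau_pair => /andP[/proper_partP[v [w [_ vj we wj]]] /eqP->].
  by split; [exists v | exists w; rewrite inE wj].
by case: i le_in => [|i] lt_in; [case: (step 0%N) | case: (step i)].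
Qed.

Lemma unified_path_uniq v i j : v \in P i -> v \in P j -> i = j.
Proof.
case/and5P: EP_path => _ _ /(pairwiseP set0) disj _ _.
have lt_size k : v \in P k -> (k < size S)%N.
  by move=> vk; rewrite ltnNge; apply/negP => /(nth_default set0) eq0;
    rewrite eq0 inE in vk.
suff no_lt k l : v \in P k -> v \in P l -> ~ (k < l)%N.
  move=> vi vj.
  by case: (ltngtP i j) => // [/(no_lt _ _ vi vj)|/(no_lt _ _ vj vi)].
move=> vk vl lt_kl; have := disj k l (lt_size k vk) (lt_size l vl) lt_kl.
by case/pred0Pn; exists v; apply/andP.
Qed.

Lemma unified_path_cover v : exists2 i, (i <= n)%N & v \in P i.
Proof.
case/and5P: EP_path => _ _ _ _ /eqP cov.
have : v \in \bigcup_(A <- S) A by rewrite cov.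
rewrite bigcup_seq => /bigcupP[A AS vA].
exists (index A S); last by rewrite nth_index.
by have := AS; rewrite -index_mem size_tuple.
Qed.

Lemma unified_path_edges : perm_eq (hedges EP) [seq link P i | i <- iota 0 n].
Proof. by case/and5P: EP_path => _ _ _; rewrite /walk_edges size_tuple. Qed.

Lemma link_inj i j : (i < n)%N -> (j < n)%N -> link P i = link P j -> i = j.
Proof.
move=> lt_in lt_jn eq_ij.
have [v vi] := unified_path_ex (ltnW lt_in);
  have [w wi] := unified_path_ex lt_in.
have := linkP unified_path_uniq j vi; have := linkP unified_path_uniq j wi.
by rewrite -eq_ij !inE vi wi orbT; lia.
Qed.

Lemma uniq_hedges : uniq (hedges EP).
Proof.
rewrite (perm_uniq unified_path_edges) map_inj_in_uniq ?iota_uniq //.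
by move=> i j; rewrite !mem_iota !add0n => /andP[_ ?] /andP[_ ?];
  apply: link_inj.
Qed.

Lemma mem_hedges e :
  reflect (exists2 i, (i < n)%N & e = link P i) (e \in hedges EP).
Proof.
rewrite (perm_mem unified_path_edges); apply: (iffP mapP) => [[i]|[i lt_in ->]].
  by rewrite mem_iota => /andP[_ lt_in] ->; exists i.
by exists i; rewrite // mem_iota.
Qed.

Lemma unified_index_path : unified_index EP = path_parts n P.
Proof.
apply/setP=> A; rewrite !inE;
  apply/orP/existsP => [[/hasP[e]|/imsetP[v _ ->]]|[i pA]].
- case/mem_hedges=> i lt_in ->; rewrite mem_parts => pA.
  by exists (Ordinal lt_in).
- have [k le_kn vk] := unified_path_cover v.
  have [i lt_in ki] : exists2 i, (i < n)%N & (k == i) || (k == i.+1).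
    case: k le_kn {vk} => [|k] le_kn; first by exists 0%N.
    by exists k; rewrite ?eqxx ?orbT.
  exists (Ordinal lt_in) => /=.
  have [l [le_ln li lk]] :
      exists l, [/\ (l <= n)%N, (l == i) || (l == i.+1) & l != k].
    by case/orP: ki => /eqP ->; [exists i.+1 | exists i]; split; lia.
  have [w wl] := unified_path_ex le_ln.
  apply/proper_partP; exists v, w; rewrite sub1set !inE eqxx.
  rewrite -!in_setU -/(link P i) !(linkP unified_path_uniq i vk).
  rewrite (linkP unified_path_uniq i wl).
  split=> //; apply: contraNneq lk => eqw; rewrite eqw in wl.
  by rewrite (unified_path_uniq wl vk).
left; apply/hasP; exists (link P i); rewrite ?mem_parts //.
by apply/mem_hedges; exists i.
Qed.

(** The edges are distinct and have at least two vertices, so that every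
    multiplicity is 1 and the diagonal vanishes. *)
Lemma unified_entry_path A B : unified_entry EP A B = adj n P A B.
Proof.
rewrite /unified_entry ifF; last first.
  apply/negbTE/negP=> /and3P[_ /cards1P[v eqA] /mem_hedges[i lt_in eqAi]].
  have [w wi] := unified_path_ex (ltnW lt_in);
    have [w' wi'] := unified_path_ex lt_in.
  have : w \in A by rewrite eqAi inE wi.
  have : w' \in A by rewrite eqAi inE wi' orbT.
  rewrite eqA !inE => /eqP eq_w' /eqP eq_w; rewrite eq_w' -eq_w in wi'.
  by have := unified_path_uniq wi wi'; lia.
case: pickP => [e /andP[eH]|none].
  rewrite tau_pair => /andP[pA /eqP->];
    rewrite /mult count_uniq_mem ?uniq_hedges // eH.
  have /mem_hedges[i lt_in eq_e] := eH; rewrite eq_e in pA *.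
  by have -> : adj n P A (link P i :\: A) by apply/adjP; exists i.
case: (boolP (adj n P A B)) => // /adjP[i [lt_in pA eqB]].
have := none (link P i); rewrite tau_pair pA eqB eqxx !andbT.
by move/negP; case; apply/mem_hedges; exists i.
Qed.

Lemma char_poly_unified_path (R : comNzRingType) :
  char_poly (unified_matrix R EP) =
    seq_det (weight n P R) (enum (path_parts n P)).
Proof.
rewrite -unified_index_path (@seq_detE _ _ _ set0 _ #|unified_index EP|)
  -?cardE //.
congr (\det _); apply/matrixP=> i j; rewrite !mxE unified_entry_path.
by rewrite -!enum_val_nth /weight (inj_eq enum_val_inj) rmorph_nat.
Qed.

Lemma part_size_gt0 i : (i <= n)%N -> (0 < part_size S i)%N.
Proof. by case/unified_path_ex=> v vi; apply/card_gt0P; exists v. Qed.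

(** This form displays 2 ^ a - 2 as an even number without truncation. *)
Lemma expn_part_size i : (i <= n)%N ->
  exists q, (2 ^ part_size S i = q.*2.+2)%N.
Proof.
move/part_size_gt0; case: part_size => // a _; exists (2 ^ a).-1.
by have := expn_gt0 2 a; rewrite expnS; lia.
Qed.

Lemma card_link i : #|link P i| = (part_size S i + part_size S i.+1)%N.
Proof.
rewrite cardsU; have -> : P i :&: P i.+1 = set0; last by rewrite cards0 subn0.
apply/setP=> v; rewrite !inE; apply/negbTE/andP => -[vi vi1].
by have := unified_path_uniq vi vi1; lia.
Qed.

(** With x = 2 ^ a and y = 2 ^ b, this is the identity
    (x y - 2) / 2 = (x - 2) (y - 2) / 2 + 1 + (x - 2) + (y - 2). *)
Lemma card_tau_link i : (i < n)%N ->
  (#|tau (link P i)| =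
    ((2 ^ part_size S i - 2) * (2 ^ part_size S i.+1 - 2))./2 + 1 +
    (2 ^ part_size S i - 2) + (2 ^ part_size S i.+1 - 2))%N.
Proof.
move=> lt_in; have e0 : link P i != set0.
  by have [v vi] := unified_path_ex (ltnW lt_in); apply/set0Pn; exists v;
    rewrite inE vi.
have := card_tau e0; rewrite card_link expnD.
have [q ->] := expn_part_size (ltnW lt_in); have [r ->] := expn_part_size lt_in.
have -> : (((q.*2.+2 - 2) * (r.*2.+2 - 2))./2 = 2 * q * r)%N.
  by rewrite !subn2 /= -[RHS]doubleK; congr (_./2); nia.
nia.
Qed.

(** In the sum of [card_tau_link] over the edges, each inner part is counted
    twice and each end once. *)
Lemma tau_total_path :
  tau_total EP =
    (n + path_t S + (\sum_(1 <= j < n) (2 ^ part_size S j - 2)).*2)%N.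
Proof.
rewrite /tau_total (perm_big _ unified_path_edges) big_map /=.
have -> : iota 0 n = index_iota 0 n by rewrite /index_iota subn0.
rewrite big_mkord.
rewrite (eq_bigr _ (fun i _ => card_tau_link (ltn_ord i))).
rewrite !big_split /= sum1_card card_ord path_tE; last exact: part_size_gt0.
case: n n_gt0 S => // m _ T.
rewrite [X in (_ + X + _)%N]big_ord_recl [X in (_ + X)%N]big_ord_recr /=.
rewrite big_add1 big_mkord /=.
rewrite -[(\sum_(i < m) (2 ^ part_size T (bump 0 i) - 2))%N]/
  (\sum_(i < m) (2 ^ part_size T i.+1 - 2))%N.
lia.
Qed.

End UnifiedPath.

(** * The spectrum *)

Lemma prod_star_poly (K : comNzRingType) (n : nat) (q : nat -> nat) :
  (0 < n)%N ->
  \prod_(j < n.+1) star_poly n K j ^+ q j =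
    ('X ^+ 2 - 1) ^+ (q 0%N + q n) *
    ('X ^+ 3 - 'X *+ 2) ^+ (\sum_(1 <= j < n) q j).
Proof.
case: n => // n _; rewrite big_ord_recl big_ord_recr big_add1 big_mkord.
(* bump 0 n is the index of the last factor. *)
rewrite {1}/star_poly /= -[bump 0 n]/n.+1 {2}/star_poly eqxx orbT.
rewrite (eq_bigr (fun j : 'I_n => ('X ^+ 3 - 'X *+ 2) ^+ q j.+1)); last first.
  by move=> j _; rewrite /star_poly /= eqSS ltn_eqF.
by rewrite prodrXr exprD -mulrA; congr (_ * _); apply: mulrC.
Qed.

Lemma prod_XsubC_pm1 (K : comNzRingType) t :
  \prod_(x <- nseq t 1 ++ nseq t (-1)) ('X - x%:P) =
    ('X ^+ 2 - 1) ^+ t :> {poly K}.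
Proof.
rewrite big_cat !big_nseq !iter_mulr_1 /= -exprMn; congr (_ ^+ _).
by rewrite polyCN polyC1; ring.
Qed.

Lemma prod_XsubC_sqrt2 (K : rcfType) t :
  \prod_(x <- nseq t 0 ++ nseq t (Num.sqrt 2) ++ nseq t (- Num.sqrt 2))
     ('X - x%:P) = ('X ^+ 3 - 'X *+ 2) ^+ t :> {poly K}.
Proof.
rewrite !big_cat !big_nseq !iter_mulr_1 /= -!exprMn; congr (_ ^+ _).
rewrite polyCN polyC0 subr0 opprK -subr_sqr -polyC_exp sqr_sqrtr ?ler0n //.
by rewrite polyC_natr; ring.
Qed.

(* When an end part is big but no two consecutive parts are, path_t S is still
   positive and +1, -1 do occur; hence the last two disjuncts below. *)
Theorem theorem7p2 (R : realType) (V : finType) (EP : hypergraph V) (n : nat)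
    (S : n.+1.-tuple {set V}) (n_ge2 : (2 <= n)%N)
    (EP_path : unified_path EP S)
    (EP_big : exists i : 'I_n.+1, (1 < part_size S i)%N) :
  let t := path_t S in
  let t' := path_t' S EP in
  unified_eigenvalues EP
    ([seq 2 * cos (pi * k%:R / (n + 2)%:R) : R | k <- iota 1 n.+1]
     ++ (if [|| consecutive_big S, (1 < part_size S 0)%N | (1 < part_size S n)%N]
         then nseq t 1 ++ nseq t (- 1) else [::])
     ++ (if tau_total EP != (n + t)%N
         then nseq t' 0 ++ nseq t' (Num.sqrt 2) ++ nseq t' (- Num.sqrt 2)
         else [::])).
Proof.
move=> t t'; have n_gt0 : (0 < n)%N := ltnW n_ge2.
have P_gt0 := part_size_gt0 n_gt0 EP_path.
have tauE := tau_total_path n_gt0 EP_path.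
set s := (\sum_(1 <= j < n) _)%N in tauE.
have t'E : t' = s.
  by rewrite /t' /path_t' tauE -addnA addKn addKn doubleK.
rewrite /unified_eigenvalues addn2 big_cat -path_poly_factor.
rewrite (char_poly_unified_path n_gt0 EP_path).
rewrite (set_det_path_parts (unified_path_ex n_gt0 EP_path)
  (unified_path_uniq EP_path)) //.
congr (_ * _); rewrite big_cat /=.
rewrite (@prod_star_poly _ n (fun j => 2 ^ part_size S j - 2)%N) // prodrXr.
rewrite mulrAC -exprD; congr (_ * _).
  transitivity (('X ^+ 2 - 1) ^+ t : {poly R}).
    by congr (_ ^+ _); rewrite /t path_tE // addnC addnA.
  case: ifP => [_|small]; first by rewrite prod_XsubC_pm1.
  rewrite big_nil; suff -> : t = 0%N by [].
  move: small; rewrite /t path_tE // => /norP[cb /norP[small0 smalln]].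
  (* No end is big and no two consecutive parts are, so every summand of t
     vanishes. *)
  have small_q i : ~~ (1 < part_size S i)%N -> (2 ^ part_size S i - 2 = 0)%N.
    by case: (part_size S i) => [|[|a]].
  rewrite !small_q // !addn0 big1 // => i _.
  move/existsPn: cb => /(_ i); rewrite negb_and => /orP[] /small_q ->;
    by rewrite ?muln0.
rewrite -/s -t'E; case: ifP => [_|/negbFE/eqP tau_eq].
  by rewrite prod_XsubC_sqrt2.
rewrite big_nil; suff -> : t' = 0%N by [].
by rewrite t'E; move: tau_eq; rewrite tauE /t; lia.
Qed.
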